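(* Suppose that (i) $K:(-\infty,\infty)^2\to(-\infty,\infty)$ is a symmetric, homogeneous and twice differentiable mean; (ii) $M,N:(0,\infty)^2\to(0,\infty)$ are two means; (iii) $r:(0,\infty)\to(-\infty,\infty)$ satisfies $\lim_{x\to\infty}r(x)=0$. Then for fixed real numbers $\epsilon,\epsilon^{\ast},\theta,\sigma$ with $\epsilon+\epsilon^{\ast}=1$ (and $x>-\min(1,\theta,\sigma)$), we have $$\Gamma(x+1)\sim\sqrt{2\pi}\,M(x+\theta,x+\sigma)^{K(x+\epsilon,x+\epsilon^{\ast})}\,e^{-M(x+\theta,x+\sigma)}\,e^{r(x)}\quad\text{as }x\to\infty.$$
   Context: $\Gamma$ is Euler's gamma function. For an interval $I\subseteq\mathbb{R}$, a function $M:I^2\to\mathbb{R}$ is a (bivariate) mean if $\min(a,b)\le M(a,b)\le\max(a,b)$ for all $a,b\in I$. It is symmetric if $M(a,b)=M(b,a)$ for all $a,b\in I$, and homogeneous (of degree one) if $M(ta,tb)=tM(a,b)$ for all $a,b\in I$ and $t>0$. Twice differentiable means twice differentiable as a function of two variables. The notation $f(x)\sim g(x)$ as $x\to\infty$ means $\lim_{x\to\infty}f(x)/g(x)=1$. *)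

(* Defs.v *)
From HB Require Import structures.
From mathcomp Require Import all_boot all_order all_algebra.
From mathcomp Require Import all_classical all_reals all_analysis.

Set Implicit Arguments.
Unset Strict Implicit.
Unset Printing Implicit Defensive.

Import Order.TTheory GRing.Theory Num.Theory.
Import numFieldNormedType.Exports.

Local Open Scope classical_set_scope.
Local Open Scope ring_scope.

Section Means.
Variable R : realType.

(* A function on I^2 is represented by a total function whose values outside
   I^2 are unconstrained. In particular a mean on ]0, +oo[ automatically takes
   positive values on ]0, +oo[^2. *)
Definition is_mean (I : interval R) (M : R -> R -> R) : Prop :=
  forall a b, a \in I -> b \in I -> Num.min a b <= M a b <= Num.max a b.

Definition symmetric_on (I : interval R) (M : R -> R -> R) : Prop :=
  forall a b, a \in I -> b \in I -> M a b = M b a.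

(* Only used for intervals stable under multiplication by t > 0. *)
Definition homogeneous_on (I : interval R) (M : R -> R -> R) : Prop :=
  forall a b t, a \in I -> b \in I -> 0 < t -> M (t * a) (t * b) = t * M a b.

(* K is Frechet differentiable on R^2 and so is its differential q |-> 'd K q;
   since R^2 has finite dimension, the latter amounts to the differentiability
   of q |-> 'd K q v for every vector v. *)
Definition twice_differentiable (K : R -> R -> R) : Prop :=
  let f := fun p : R * R => K p.1 p.2 in
  (forall p : R * R, differentiable f p) /\
  (forall v p : R * R, differentiable (fun q : R * R => 'd f q v) p).

End Means.

(* Euler's integral, which defines the gamma function at x > 0; the value for
   x <= 0 is not meaningful. *)
Definition Gamma (R : realType) (x : R) : R :=
  \int[lebesgue_measure]_(t in `]0, +oo[) (t `^ (x - 1) * expR (- t)).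

Definition asymp_equiv (R : realType) (f g : R -> R) : Prop :=
  f x / g x @[x --> +oo] --> (1 : R).

(* Main.v *)
(* Laplace's method: substituting [t = r ^+ 2 + r * s] in Euler's integral for
   [Gamma (r ^+ 2 + 1)] pulls out the factor [x ^ x * exp (- x) * sqrt x] with
   [x = r ^+ 2]; two-sided bounds for [ln] show that the remaining integrand
   tends pointwise to [exp (- s ^+ 2 / 2)] and is dominated by the sum of a
   Gaussian and an exponential, which gives Stirling's formula.
   For the mean [K], homogeneity gives [K (x + e) (x + e') = x * g (1 / x)] with
   [g h = K (1 + e * h) (1 + e' * h)]; symmetry forces [g' 0 = 1 / 2] and the
   second derivative gives [K (x + e) (x + e') = x + 1 / 2 + O (1 / x)].
   Finally, when [m - x] is bounded and [k = x + 1 / 2 + O (1 / x)], the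
   first-order effect of [m - x] cancels and [k ln m - m] differs from
   [(x + 1 / 2) ln x - x] by [O (1 / sqrt x)]. *)
Require Import Defs.
From mathcomp Require Import all_boot all_order all_algebra.
From mathcomp Require Import all_classical all_reals all_analysis.
From mathcomp Require Import measurable_realfun ring lra.
Import Order.TTheory GRing.Theory Num.Theory.
Import numFieldNormedType.Exports.
Local Open Scope classical_set_scope.
Local Open Scope ring_scope.

Section Stirling.
Variable R : realType.
Implicit Types x y s : R.

(** * Two-sided bounds for the logarithm and for the rescaled exponent *)

Lemma derive_ge0_le (f df : R -> R) (a b : R) :
    (forall y, 0 < y -> is_derive y 1 f (df y)) ->
    (forall y, 0 < y -> 0 <= df y) ->
  0 < a -> a <= b -> f a <= f b.
Proof.
move=> fdf df0 a0 ab.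
have [y||c] := @MVT_segment R f df a b ab.
- by rewrite in_itv/= => /andP[ay _]; apply: fdf; exact: lt_trans ay.
- apply: derivable_within_continuous => y; rewrite in_itv/= => /andP[ay _].
  by apply/ex_derive/fdf; exact: lt_le_trans ay.
rewrite in_itv/= => /andP[ac _] fE.
by rewrite -subr_ge0 fE mulr_ge0 ?subr_ge0// df0// (lt_le_trans a0).
Qed.

(** The error of the second-order Taylor polynomial of [ln] at 1. Its derivative [(y - 1) ^+ 2 / y]
    is nonnegative, so its sign is that of [y - 1]. *)
Let ln_quad y := ln y - (y - 1) + (y - 1) ^+ 2 / 2.

Let ln_quad_le a b : 0 < a -> a <= b -> ln_quad a <= ln_quad b.
Proof.
apply: (@derive_ge0_le _ (fun y => (y - 1) ^+ 2 / y)) => y y0; last first.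
  by rewrite divr_ge0 ?sqr_ge0// ltW.
have yN0 : y != 0 by rewrite gt_eqF.
have := is_derive1_ln y0 => ?.
rewrite /ln_quad; apply: is_derive_eq.
by rewrite /GRing.scale/=; field.
Qed.

(** The companion comparison function, also zero at 1, with derivative [(1 - y^-1) ^+ 2 / 2]; it
    bounds [ln] on the side that [ln_quad] leaves open. *)
Let ln_hyp y := (y - y^-1) / 2 - ln y.

Let ln_hyp_le a b : 0 < a -> a <= b -> ln_hyp a <= ln_hyp b.
Proof.
apply: (@derive_ge0_le _ (fun y => (1 - y^-1) ^+ 2 / 2)) => y y0; last first.
  by rewrite divr_ge0 ?sqr_ge0.
have yN0 : y != 0 by rewrite gt_eqF.
have := is_derive1_ln y0 => ?.
have := @is_deriveV R id y 1 1 yN0 (is_derive_id _ _) => ?.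
rewrite /ln_hyp; apply: is_derive_eq.
by rewrite /GRing.scale/=; field.
Qed.

(** Both comparison functions vanish at 1 and are nondecreasing: [ln_quad] gives the lower bound and
    [ln_hyp] the upper one. Below 1 the roles are exchanged. *)
Lemma ln_bounds_ge1 y : 1 <= y ->
  - ((y - 1) ^+ 2 / 2) <= ln y - (y - 1) <= - ((y - 1) ^+ 2 / (2 * y)).
Proof.
move=> y1; have y0 : 0 < y by exact: lt_le_trans y1.
have := ln_quad_le _ _ ltr01 y1; have := ln_hyp_le _ _ ltr01 y1.
rewrite /ln_quad /ln_hyp ln1 invr1 subrr.
have -> : (y - 1) ^+ 2 / (2 * y) = (y + y^-1) / 2 - 1.
  by field; rewrite gt_eqF.
by move=> ? ?; apply/andP; split; lra.
Qed.

Lemma ln_bounds_le1 y : 0 < y -> y <= 1 ->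
  - ((y - 1) ^+ 2 / (2 * y)) <= ln y - (y - 1) <= - ((y - 1) ^+ 2 / 2).
Proof.
move=> y0 y1; have := ln_quad_le _ _ y0 y1; have := ln_hyp_le _ _ y0 y1.
rewrite /ln_quad /ln_hyp ln1 invr1 subrr.
have -> : (y - 1) ^+ 2 / (2 * y) = (y + y^-1) / 2 - 1.
  by field; rewrite gt_eqF.
by move=> ? ?; apply/andP; split; lra.
Qed.

(* With [x = r ^+ 2], the substitution [t = r ^+ 2 + s * r] turns
   [t ^ x * exp (- t)] into [x ^ x * exp (- x) * exp (saddle r s)]. *)
Definition saddle r s := r ^+ 2 * ln (1 + s / r) - s * r.

Lemma saddleE r s : r != 0 ->
  saddle r s = r ^+ 2 * (ln (1 + s / r) - (1 + s / r - 1)).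
Proof. by move=> r0; rewrite /saddle; field. Qed.

Lemma saddle_bounds_ge0 r s : 0 < r -> 0 <= s ->
  - (s ^+ 2 / 2) <= saddle r s <= - (s ^+ 2 / (2 * (1 + s / r))).
Proof.
move=> r0 s0; have rN0 : r != 0 by rewrite gt_eqF.
have : 0 <= s / r by rewrite divr_ge0// ltW.
rewrite saddleE//; move: (s / r) (divfK rN0 s) => u <- u0.
have /ln_bounds_ge1/andP[lo hi] : 1 <= 1 + u by lra.
have r2 : 0 < r ^+ 2 by rewrite exprn_gt0.
have scale z : - ((u * r) ^+ 2 / z) = r ^+ 2 * - ((1 + u - 1) ^+ 2 / z).
  by rewrite addrAC subrr add0r exprMn; ring.
by rewrite !scale !ler_pM2l// lo hi.
Qed.

Lemma saddle_bounds_le0 r s : 0 < r -> - r < s -> s <= 0 ->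
  - (s ^+ 2 / (2 * (1 + s / r))) <= saddle r s <= - (s ^+ 2 / 2).
Proof.
move=> r0 rs s0; have rN0 : r != 0 by rewrite gt_eqF.
have u0 : s / r <= 0 by rewrite ler_pdivrMr// mul0r.
have : 0 < 1 + s / r by rewrite -ltrBlDl sub0r ltr_pdivlMr// mulN1r.
rewrite saddleE//; move: (s / r) (divfK rN0 s) u0 => u <- u0 u1.
have /(ln_bounds_le1 _ u1)/andP[lo hi] : 1 + u <= 1 by lra.
have r2 : 0 < r ^+ 2 by rewrite exprn_gt0.
have scale z : - ((u * r) ^+ 2 / z) = r ^+ 2 * - ((1 + u - 1) ^+ 2 / z).
  by rewrite addrAC subrr add0r exprMn; ring.
by rewrite !scale !ler_pM2l// lo hi.
Qed.

(** * The rescaled integrand: majorant, pointwise limit, limit of the integral *)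

(** The cutoff at [- r] is the image of [t = 0]. Extension by zero makes the domain of integration
    independent of [r], as dominated convergence requires. *)
Definition laplace_kernel r : R -> R :=
  (fun s => expR (saddle r s)) \_ `]- r, +oo[.

Lemma laplace_kernelE r s : - r < s -> laplace_kernel r s = expR (saddle r s).
Proof. by move=> rs; rewrite /laplace_kernel patchE ifT// inE/= in_itv/= rs. Qed.

Lemma laplace_kernel0 r s : s <= - r -> laplace_kernel r s = 0.
Proof.
move=> sr; rewrite /laplace_kernel patchE ifF//.
by apply/negP; rewrite inE/= in_itv/= andbT ltNge sr.
Qed.

Lemma laplace_kernel_ge0 r s : 0 <= laplace_kernel r s.
Proof.
have [sr|rs] := leP s (- r); first by rewrite laplace_kernel0.
by rewrite laplace_kernelE// expR_ge0.
Qed.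

Lemma measurable_laplace_kernel r : measurable_fun setT (laplace_kernel r).
Proof.
apply/(measurable_restrict _ _ _).1 => //=.
apply: measurable_funTS; apply: measurableT_comp => //.
apply: measurable_funB; last exact: measurable_funM.
apply: measurable_funM => //.
apply: (measurableT_comp (@measurable_ln R)).
by apply: measurable_funD => //; exact: measurable_funM.
Qed.

(** The Gaussian dominates for [s <= 0]; for [s > 0] the second term is [expR (2^-1 - 2^-1 * s)].
    Writing it with a probability density makes its integrability immediate. *)
Definition laplace_majorant s : R :=
  expR (- (s ^+ 2 / 2)) + 2 * expR 2^-1 * exponential_pdf 2^-1 s.

Lemma laplace_kernel_le r s : 1 <= r -> laplace_kernel r s <= laplace_majorant s.
Proof.
move=> r1; have r0 : 0 < r by exact: lt_le_trans r1.
have expo_ge0 : 0 <= 2 * expR 2^-1 * exponential_pdf 2^-1 s.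
  by rewrite !mulr_ge0 ?expR_ge0 ?exponential_pdf_ge0 ?invr_ge0.
have [sr|rs] := leP s (- r).
  by rewrite laplace_kernel0// addr_ge0 ?expR_ge0.
rewrite laplace_kernelE//; have [s0|s0] := leP s 0.
  have /andP[_ le] := saddle_bounds_le0 r s r0 rs s0.
  rewrite (@le_trans _ _ (expR (- (s ^+ 2 / 2))))// ?ler_expR//.
  by rewrite lerDl.
have /andP[_ le] := saddle_bounds_ge0 r s r0 (ltW s0).
rewrite (@le_trans _ _ (2 * expR 2^-1 * exponential_pdf 2^-1 s))//; last first.
  by rewrite lerDr expR_ge0.
rewrite exponential_pdfE; last exact: ltW.
have -> : 2 * expR 2^-1 * (2^-1 * expR (- 2^-1 * s)) = expR (2^-1 - 2^-1 * s).
  by rewrite expRD -mulNr; field.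
rewrite ler_expR.
apply: le_trans le _.
(* As [r >= 1], replacing [s / r] by [s] weakens the bound; then [(s - 1) * (s + 1) <= s ^+ 2] makes
   it linear in [s]. *)
rewrite (@le_trans _ _ (- (s ^+ 2 / (2 * (1 + s)))))//.
  rewrite lerN2 ler_pM2l ?exprn_gt0// lef_pV2 ?posrE ?mulr_gt0 ?addr_gt0 ?divr_gt0//.
  by rewrite ler_pM2l// lerD2l ler_pdivrMr// ler_peMr// ltW.
by rewrite lerNl ler_pdivlMr ?mulr_gt0 ?addr_gt0//; nra.
Qed.

Lemma gaussianE s : expR (- (s ^+ 2 / 2)) = Num.sqrt (2 * pi) * normal_pdf 0 1 s.
Proof.
have pk : Num.sqrt (2 * pi : R) != 0.
  by rewrite gt_eqF// sqrtr_gt0 mulr_gt0 ?pi_gt0.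
rewrite normal_pdfE ?oner_neq0//= /normal_peak /normal_fun.
by rewrite expr1n mul1r subr0 -(mulr_natl pi) mulVKf// mulNr.
Qed.

Let mu : {measure set _ -> \bar R} := @lebesgue_measure R.

Lemma integrable_laplace_majorant :
  mu.-integrable setT (EFin \o laplace_majorant).
Proof.
apply: (@integrableD _ _ _ mu setT measurableT
  (EFin \o fun s => expR (- (s ^+ 2 / 2)))
  (EFin \o fun s => 2 * expR 2^-1 * exponential_pdf 2^-1 s)).
  rewrite (_ : _ \o _ = fun s => ((Num.sqrt (2 * pi))%:E * (normal_pdf 0 1 s)%:E)%E).
    exact/integrableZl/integrable_normal_pdf.
  by apply/funext => s /=; rewrite gaussianE EFinM.
rewrite (_ : _ \o _ =
    fun s => ((2 * expR 2^-1)%:E * (exponential_pdf 2^-1 s)%:E)%E).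
  by apply/integrableZl/integrable_exponential_pdf; rewrite ?invr_gt0.
by apply/funext => s /=; rewrite EFinM.
Qed.

Lemma integral_gaussian :
  (\int[mu]_s (expR (- (s ^+ 2 / 2)))%:E = (Num.sqrt (2 * pi))%:E)%E.
Proof.
under eq_integral do rewrite gaussianE EFinM.
rewrite ge0_integralZl//=.
- by rewrite integral_normal_pdf mule1.
- by apply/measurable_EFinP; exact: measurable_normal_pdf.
- by move=> s _; rewrite lee_fin normal_pdf_ge0.
Qed.

Lemma cvgVy : x^-1 @[x --> +oo] --> (0 : R).
Proof.
apply: (gtr0_cvgV0 _).2; last exact: cvg_id.
exact: nbhs_pinfty_gt.
Qed.

(** Squeeze: for either sign of [s], one bound is the limit itself and the other tends to it because
    [s / r] tends to 0. *)
Lemma cvg_saddle s : saddle r s @[r --> +oo] --> - (s ^+ 2 / 2).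
Proof.
have one : 1 + s / r @[r --> +oo] --> (1 : R).
  rewrite -[X in _ --> X]addr0; apply: cvgD; first exact: cvg_cst.
  rewrite -(mulr0 s); apply: cvgM; first exact: cvg_cst.
  exact: cvgVy.
have quad : - (s ^+ 2 / (2 * (1 + s / r))) @[r --> +oo] --> - (s ^+ 2 / 2).
  apply: cvgN; apply: cvgM; first exact: cvg_cst.
  have two : 2 * (1 + s / r) @[r --> +oo] --> (2 * 1 : R).
    by apply: cvgM one; exact: cvg_cst.
  by apply: cvgV => //; rewrite mulr1 in two.
have [s0|s0] := leP 0 s.
- apply: (@squeeze_cvgr _ _ _ _ (cst (- (s ^+ 2 / 2)))
    (fun r => - (s ^+ 2 / (2 * (1 + s / r))))) => //.
  by near=> r; apply: saddle_bounds_ge0.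
  exact: cvg_cst.
- apply: (@squeeze_cvgr _ _ _ _ (fun r => - (s ^+ 2 / (2 * (1 + s / r))))
    (cst (- (s ^+ 2 / 2)))) => //; last exact: cvg_cst.
  near=> r; apply: saddle_bounds_le0 => //; last exact: ltW.
  rewrite ltrNl; near: r; apply: nbhs_pinfty_gt; exact: num_real.
Unshelve. all: by end_near. Qed.

Lemma cvg_laplace_kernel s :
  laplace_kernel r s @[r --> +oo] --> expR (- (s ^+ 2 / 2)).
Proof.
have : expR (saddle r s) @[r --> +oo] --> expR (- (s ^+ 2 / 2)).
  by apply: continuous_cvg; [exact: continuous_expR|exact: cvg_saddle].
apply: cvg_trans; apply: near_eq_cvg.
near=> r; rewrite laplace_kernelE// ltrNl.
near: r; apply: nbhs_pinfty_gt; exact: num_real.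
Unshelve. all: by end_near. Qed.

Lemma integrable_laplace_kernel r : 1 <= r ->
  mu.-integrable setT (EFin \o laplace_kernel r).
Proof.
move=> r1; apply: le_integrable integrable_laplace_majorant => //.
  by apply/measurable_EFinP; exact: measurable_laplace_kernel.
move=> s _ /=; rewrite lee_fin ger0_norm ?laplace_kernel_ge0//.
exact: le_trans (laplace_kernel_le r s r1) (ler_norm _).
Qed.

Lemma cvg_integral_laplace_kernel :
  \int[mu]_s laplace_kernel r s @[r --> +oo] --> Num.sqrt (2 * pi : R).
Proof.
apply/cvg_pinftyP => u uoo.
(* The majorant is valid only for [r >= 1], whereas domination is required at every [n]; [v] and [u]
   agree eventually. *)
pose v n := Num.max 1 (u n).
have voo : v n @[n --> \oo] --> +oo.
  by apply: ger_cvgy uoo; near=> n; rewrite /v le_max lexx orbT.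
have : \int[mu]_s laplace_kernel (v n) s @[n --> \oo] --> Num.sqrt (2 * pi : R).
  apply: fine_cvg; rewrite -integral_gaussian.
  have [|||||_ _ //] := @dominated_convergence _ _ _ mu setT measurableT
    (fun n => EFin \o laplace_kernel (v n))
    (fun s => (expR (- (s ^+ 2 / 2)))%:E) (EFin \o laplace_majorant).
  - by move=> n; apply/measurable_EFinP; exact: measurable_laplace_kernel.
  - apply/measurable_EFinP; apply: measurableT_comp => //.
    by apply: measurableT_comp => //; exact: measurable_funM.
  - apply: aeW => s _; apply: cvg_EFin; first exact: nearW.
    exact: (cvg_comp v (laplace_kernel ^~ s) voo (cvg_laplace_kernel s)).
  - exact: integrable_laplace_majorant.
  - apply: aeW => s n _ /=; rewrite lee_fin ger0_norm ?laplace_kernel_ge0//.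
    by apply: laplace_kernel_le; rewrite /v le_max lexx.
apply: cvg_trans; apply: near_eq_cvg; near=> n.
rewrite /v max_r//; near: n.
by apply: (cvgryPge _).1.
Unshelve. all: by end_near. Qed.

(** * Change of variables in Euler's integral and Stirling's formula *)

Lemma continuous_Gamma_integrand x : 0 < x ->
  {within `[0, +oo[, continuous (fun t : R => t `^ x * expR (- t))}.
Proof.
move=> x0.
have cexpN (t : R) : {for t, continuous (fun t : R => expR (- t))}.
  by apply: continuous_comp; [exact: continuousN|exact: continuous_expR].
apply/continuous_within_itvcyP; split=> [t t0|].
  apply: cvgM; last exact: cexpN.
  have /derivable1_diffP/differentiable_continuous := @derivable_powR R 1 x _ t0.
  exact.
(* At the endpoint 0 continuity relies on [x > 0], which makes the power vanish there. *)
rewrite powR0 ?gt_eqF//; apply: cvgM; first exact: powR_cvg0.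
by apply: cvg_at_right_filter; exact: cexpN.
Qed.

Lemma Gamma_laplace r : 1 <= r ->
  Gamma (r ^+ 2 + 1) = (r ^+ 2) `^ (r ^+ 2) * expR (- r ^+ 2) * r *
    \int[mu]_s laplace_kernel r s.
Proof.
move=> r1; have r0 : 0 < r by exact: lt_le_trans r1.
have rN0 : r != 0 by rewrite gt_eqF.
have x0 : 0 < r ^+ 2 by rewrite exprn_gt0.
set x := r ^+ 2 in x0 *.
pose G t := t `^ x * expR (- t).
have mG : measurable_fun setT G.
  apply: measurable_funM; first exact: measurable_powR.
  by apply: measurableT_comp => //; exact: measurableT_comp.
pose F s : R := x + r * s.
have F' : F^`()%classic = cst r.
  apply/funext => s; rewrite /F derive1E.
  have : is_derive s 1 (fun s => x + r * s) r.
    by apply: is_derive_eq; rewrite /GRing.scale/=; ring.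
  by move/@derive_val.
have Fr : F (- r) = 0 by rewrite /F /x mulrN expr2 subrr.
rewrite /Gamma addrK -RintegralZl//; last exact: integrable_laplace_kernel.
rewrite /laplace_kernel.
rewrite [LHS]/Rintegral [RHS]/Rintegral; congr fine.
(* The substitution is carried out on closed half-lines, so the endpoint is added here and removed
   again afterwards. *)
rewrite integral_itv_obnd_cbnd; last first.
  by apply/measurable_EFinP; exact: measurable_funTS.
rewrite -Fr (@increasing_ge0_integration_by_substitutiony _ F G); last first.
- by move=> t _; rewrite mulr_ge0 ?powR_ge0 ?expR_ge0.
- by rewrite Fr; exact: continuous_Gamma_integrand.
- apply: (ger_cvgy _ (@cvg_id _ (pinfty_nbhs R))).
  near=> s; rewrite /F ler_wpDl ?(ltW x0)//.
  by rewrite ler_peMl//; near: s; apply: nbhs_pinfty_ge; exact: num_real.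
- split; first by move=> s _; exact: ex_derive.
  apply: cvg_at_right_filter; apply: cvgD; first exact: cvg_cst.
  by apply: cvgM; [exact: cvg_cst|exact: cvg_id].
- by rewrite F'; exact: is_cvg_cst.
- by rewrite F'; exact: is_cvg_cst.
- by rewrite F' => t _; exact: cst_continuous.
- by move=> s t _ _ st; rewrite /F ltrD2l ltr_pM2l.
rewrite F' -integral_itv_obnd_cbnd; last first.
  apply/measurable_EFinP; apply: measurable_funTS; apply: measurable_funM => //.
  apply: measurableT_comp => //.
  by apply: measurable_funD => //; exact: measurable_funM.
rewrite [LHS]integral_mkcond; apply: eq_integral => s _.
rewrite !patchE; case: ifPn; last by rewrite mulr0.
rewrite inE/= in_itv/= andbT => rs; congr EFin.
have u0 : 0 < 1 + s / r.
  by rewrite -ltrBlDl sub0r ltr_pdivlMr// mulN1r.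
have FsE : F s = x * (1 + s / r) by rewrite /F /x; field.
rewrite -[LHS]/(G (F s) * r) FsE.
(* Only the power of [1 + s / r] is turned into an exponential; the power of [x] belongs to the
   prefactor. *)
rewrite /G powRM ?(ltW x0) ?(ltW u0)// {2}/powR (gt_eqF u0) /saddle.
have -> : - (x * (1 + s / r)) = - x - s * r by rewrite /x; field.
by rewrite !expRD; ring.
Unshelve. all: by end_near. Qed.

Lemma cvg_sqrty : Num.sqrt x @[x --> +oo] --> (+oo : set_system R).
Proof.
apply/cvgryPge => A; near=> x.
rewrite (le_trans (ler_norm A))// -sqrtr_sqr ler_sqrt.
  by near: x; apply: nbhs_pinfty_ge; exact: num_real.
by near: x; apply: nbhs_pinfty_ge; exact: num_real.
Unshelve. all: by end_near. Qed.

(** For [x >= 1] the quotient is exactly the integral of the kernel at [r = Num.sqrt x]. *)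
Lemma stirling :
  Gamma (x + 1) / (x `^ x * expR (- x) * Num.sqrt x) @[x --> +oo] -->
  Num.sqrt (2 * pi : R).
Proof.
apply: cvg_trans (cvg_comp _ _ cvg_sqrty cvg_integral_laplace_kernel).
apply: near_eq_cvg; near=> x => /=.
have x1 : 1 <= x by near: x; apply: nbhs_pinfty_ge; exact: num_real.
have x0 : 0 < x by exact: lt_le_trans x1.
have r1 : 1 <= Num.sqrt x by rewrite -sqrtr1 ler_sqrt// ltW.
have := Gamma_laplace _ r1; rewrite sqr_sqrtr ?(ltW x0)// => ->.
rewrite mulrC mulKf// gt_eqF// !mulr_gt0 ?powR_gt0 ?expR_gt0//.
exact: lt_le_trans r1.
Unshelve. all: by end_near. Qed.

End Stirling.

(** * Expansion at infinity of a symmetric homogeneous mean *)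

Section MeanExpansion.
Variables (R : realType) (K : R -> R -> R).
Hypothesis K_mean : is_mean `]-oo, +oo[ K.
Hypothesis K_sym : symmetric_on `]-oo, +oo[ K.
Hypothesis K_hom : homogeneous_on `]-oo, +oo[ K.
Hypothesis K_diff : twice_differentiable K.

Let f (p : R * R) := K p.1 p.2.

Let is_derive_line (p v : R * R) (h : R) :
  is_derive h 1 (fun h : R => f (p + h *: v)) ('d f (p + h *: v) v).
Proof.
have dl : differentiable (fun h : R => p + h *: v) h by apply: ex_diff.
have df := K_diff.1 (p + h *: v).
have dc : differentiable (f \o (fun h : R => p + h *: v)) h.
  exact: differentiable_comp.
apply: DeriveDef; first exact/derivable1_diffP.
rewrite (deriveE _ dc) diff_comp//=; congr ('d f _ _); rewrite diff_val.
rewrite [RHS]surjective_pairing; congr pair.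
  by rewrite -[LHS]/(0 + 1 * v.1) add0r mul1r.
by rewrite -[LHS]/(0 + 1 * v.2) add0r mul1r.
Qed.

Let diag : R * R := (1, 1).

(** A mean satisfies [K a a = a], so [f] restricted to the diagonal line is [1 + h]. *)
Let diff_diag : 'd f diag (1, 1) = 1.
Proof.
have := is_derive_line diag (1, 1) 0; rewrite scale0r addr0.
rewrite (_ : (fun h : R => _) = fun h => 1 + h); last first.
  apply/funext => h; rewrite /f /=.
  have := K_mean (1 + h * 1) (1 + h * 1) isT isT.
  by rewrite minxx maxxx -eq_le /GRing.scale/= mulr1 => /eqP.
move/@derive_val <-.
by rewrite deriveD// derive_cst add0r derive_id.
Qed.

(* [h |-> K (1 + h) (1 - h)] is even. *)
Let diff_antidiag : 'd f diag (1, - 1) = 0.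
Proof.
have := is_derive_line diag (1, -1) 0; rewrite scale0r addr0.
have := is_derive_line diag (- (1, -1)) 0; rewrite scale0r addr0.
rewrite (_ : (fun h : R => _) = fun h => f (diag + h *: (1, -1))); last first.
  apply/funext => h; rewrite /f /= /GRing.scale/= !mulrN !mulr1 !opprK.
  exact: K_sym.
move/@derive_val => d1 /@derive_val.
rewrite d1 linearN /=; lra.
Qed.

(** With [g h = f (diag + h *: v)], the mean value theorem gives [x * (g x^-1 - g 0) = df c] for
    some [0 < c < x^-1]. Since [df] is differentiable at 0 with [df 0 = 2^-1], the error is at most
    [D * c]. *)
Lemma mean_expansion e e' : e + e' = 1 ->
  exists2 D, 0 <= D &
    \forall x \near +oo, `|K (x + e) (x + e') - (x + 2^-1)| <= D / x.
Proof.
move=> ee'; pose v : R * R := (e, e').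
pose df h := 'd f (diag + h *: v) v.
have df0 : df 0 = 2^-1.
  rewrite /df scale0r addr0.
  (* Since [e + e' = 1], the diagonal component of [v] is one half whatever [e] is, and the
     antidiagonal one is killed by symmetry. *)
  have -> : v = 2^-1 *: (1, 1) + (e - 2^-1) *: (1, -1).
    rewrite /v; congr pair; rewrite /= /GRing.scale/= ?mulrN ?mulr1; first by field.
    by rewrite -(addKr e e') ee'; field.
  by rewrite linearD !linearZ/= diff_diag diff_antidiag scaler0 addr0 /GRing.scale/= mulr1.
have [D D0 [d d0 dfD]] : exists2 D, 0 <= D & exists2 d, 0 < d &
    forall h, 0 < h -> h < d -> `|df h - 2^-1| <= D * h.
  have dl : differentiable (fun h : R => diag + h *: v) 0 by apply: ex_diff.
  have : derivable df 0 1.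
    apply/derivable1_diffP.
    exact: (differentiable_comp dl (K_diff.2 v _)).
  move=> /cvg_ex[l dfl]; exists (`|l| + 1) => //.
  have : \forall h \near 0^', `|h^-1 *: ((df \o shift 0) (h *: 1) - df 0)| < `|l| + 1.
    by apply: (cvgr_norm_lt _ dfl); rewrite ltrDl.
  rewrite near_withinE => /nbhs_ballP[d /= d0 dH].
  exists d => // h h0 hd.
  have := dH h; rewrite /ball/= sub0r normrN gtr0_norm// => /(_ hd).
  rewrite gt_eqF// => /(_ isT).
  rewrite df0 addr0 /GRing.scale/= mulr1 normrM normfV (gtr0_norm h0) => /ltW.
  by rewrite ler_pdivrMl// mulrC.
exists D => //; near=> x.
have x0 : 0 < x by near: x; apply: nbhs_pinfty_gt; exact: num_real.
have xN0 : x != 0 by rewrite gt_eqF.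
have h0 : 0 < x^-1 by rewrite invr_gt0.
have hd : x^-1 < d.
  rewrite invf_plt//.
  by near: x; apply: nbhs_pinfty_gt; exact: num_real.
have -> : K (x + e) (x + e') = x * f (diag + x^-1 *: v).
  rewrite /f /= -K_hom// /GRing.scale/= !mulrDr mulr1 !mulrA divff// !mul1r.
  by [].
have [||c] := @MVT _ (fun h => f (diag + h *: v)) df _ _ h0.
- by move=> h _; exact: is_derive_line.
- by apply: derivable_within_continuous => h _; apply: ex_derive.
rewrite in_itv/= scale0r addr0 subr0 => /andP[c0 cx] gE.
have f1 : f diag = 1.
  by have := K_mean 1 1 isT isT; rewrite minxx maxxx -eq_le => /eqP.
have -> : f (diag + x^-1 *: v) = 1 + df c / x by rewrite -gE f1; ring.
have -> : x * (1 + df c / x) - (x + 2^-1) = df c - 2^-1 by field.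
apply: (le_trans (dfD _ c0 (lt_trans cx hd))).
by rewrite ler_wpM2l// ltW.
Unshelve. all: by end_near. Qed.
End MeanExpansion.

(** * Stability of the exponent under bounded changes of the base *)

Section Exponent.
Variable R : realType.
Implicit Types x : R.

(** From [ln x = 2 * ln (Num.sqrt x)] and [ln y < y]; it turns [ln x / x] into a multiple of
    [(Num.sqrt x)^-1]. *)
Lemma ln_le_sqrt x : 0 < x -> ln x <= 2 * Num.sqrt x.
Proof.
move=> x0; have s0 : 0 < Num.sqrt x by rewrite sqrtr_gt0.
by rewrite -{1}(sqr_sqrtr (ltW x0)) lnXn// mulr_natl lerMn2r/= ltW// ln_sublinear.
Qed.

Lemma exponent_bound (C D x m k : R) : 0 <= C -> 0 <= D -> 1 <= x -> 2 * C <= x ->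
  `|m - x| <= C -> `|k - (x + 2^-1)| <= D / x ->
  `|(x + 2^-1) * ln x - x - (k * ln m - m)| <=
    D * (2 * (Num.sqrt x)^-1) + (2 * C ^+ 2 + (2^-1 + D) * (2 * C)) * x^-1.
Proof.
move=> C0 D0 x1 Cx mC kD.
have x0 : 0 < x by exact: lt_le_trans x1.
have /andP[mlo mhi] : x - C <= m <= x + C by rewrite -ler_distl.
(* The assumption [2 * C <= x] serves here: it keeps [m] comparable to [x], whence the factor 2 in
   [im]. *)
have mx : x / 2 <= m by lra.
have m0 : 0 < m by lra.
(* [ln (1 + u) <= u] is used twice, for the ratio [m / x] and then for [x / m]. *)
have Lhi : ln m - ln x <= (m - x) / x.
  rewrite -ln_div ?posrE// (_ : m / x = 1 + (m - x) / x); last first.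
    by field; rewrite gt_eqF.
  by rewrite le_ln1Dx// -subr_gt0 opprK mulrBl divff ?gt_eqF// subrK divr_gt0.
have Llo : (m - x) / m <= ln m - ln x.
  rewrite -lerN2 opprB -ln_div ?posrE// (_ : x / m = 1 + - ((m - x) / m)); last first.
    by field; rewrite gt_eqF.
  rewrite le_ln1Dx// -subr_gt0 opprK mulrBl divff ?gt_eqF//.
  by rewrite opprB subrK divr_gt0.
have ix0 : 0 < x^-1 by rewrite invr_gt0.
have im : m^-1 <= 2 * x^-1.
  by rewrite -[2]invrK -invfM lef_pV2 ?posrE// ?mulr_gt0 ?invr_gt0// mulrC.
have Labs : `|ln m - ln x| <= 2 * C * x^-1.
  rewrite ler_norml; apply/andP; split.
    apply: le_trans Llo; rewrite lerNl -mulNr.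
    apply: le_trans (ler_norm _) _; rewrite normrM normrN normfV (gtr0_norm m0).
    by rewrite (mulrC 2) -mulrA ler_pM ?invr_ge0 ?(ltW m0).
  apply: le_trans Lhi _.
  apply: le_trans (ler_norm _) _; rewrite normrM normfV (gtr0_norm x0).
  by rewrite ler_pM2r// (le_trans mC)// ler_peMl// ler1n.
(* The first-order cancellation: [Lhi] makes this quantity nonnegative and [Llo] bounds it by
   [(m - x) ^+ 2 / m]. *)
have quad : `|(m - x) - x * (ln m - ln x)| <= 2 * C ^+ 2 * x^-1.
  rewrite ger0_norm; last by rewrite subr_ge0 mulrC -ler_pdivlMr.
  apply: (@le_trans _ _ ((m - x) ^+ 2 / m)).
    have -> : (m - x) ^+ 2 / m = (m - x) - x * ((m - x) / m).
      by field; rewrite gt_eqF.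
    by rewrite lerD2l lerN2 ler_pM2l.
  rewrite (mulrC 2) -(mulrA (C ^+ 2)) ler_pM ?sqr_ge0 ?invr_ge0 ?(ltW m0)//.
  by rewrite -real_normK ?num_real// ler_pXn2r ?nnegrE.
have kx : `|k - x| <= 2^-1 + D.
  rewrite (_ : k - x = 2^-1 + (k - (x + 2^-1))); last by ring.
  rewrite (le_trans (ler_normD _ _))// ger0_norm ?invr_ge0// lerD2l.
  by rewrite (le_trans kD)// ler_pdivrMr// ler_peMr.
have lnx : `|(k - (x + 2^-1)) * ln x| <= D * (2 * (Num.sqrt x)^-1).
  rewrite normrM (ger0_norm (ln_ge0 x1)).
  apply: (@le_trans _ _ (D / x * (2 * Num.sqrt x))).
    by rewrite ler_pM// ?ln_ge0// ln_le_sqrt.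
  rewrite -mulrA ler_wpM2l// -{1}(sqr_sqrtr (ltW x0)) le_eqVlt; apply/orP; left.
  by apply/eqP; field; rewrite gt_eqF// sqrtr_gt0.
(* The three terms are controlled by [lnx], by [quad], and by [kx] with [Labs], respectively. *)
rewrite (_ : _ - (k * ln m - m) = - ((k - (x + 2^-1)) * ln x) +
    ((m - x) - x * (ln m - ln x)) - (k - x) * (ln m - ln x)); last by ring.
apply: le_trans (ler_normB _ _) _.
rewrite (mulrDl (2 * C ^+ 2)) [leRHS]addrA -(mulrA (2^-1 + D)) (normrM (k - x)).
apply: lerD; last by rewrite ler_pM.
by apply: le_trans (ler_normD _ _) _; rewrite normrN lerD.
Qed.

End Exponent.

(** * Combination of Stirling's formula with the exponent estimate *)

Theorem corollary2 (R : realType) (K M N : R -> R -> R) (r : R -> R)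
    (K_mean : is_mean `]-oo, +oo[ K)
    (K_sym : symmetric_on `]-oo, +oo[ K)
    (K_hom : homogeneous_on `]-oo, +oo[ K)
    (K_diff : twice_differentiable K)
    (M_mean : is_mean `]0, +oo[ M)
    (N_mean : is_mean `]0, +oo[ N)
    (r_lim : r x @[x --> +oo] --> (0 : R))
    (eps eps' theta sigma : R) (eps_sum : eps + eps' = 1) :
  asymp_equiv (fun x => Gamma (x + 1))
    (fun x => Num.sqrt (2 * pi)
              * M (x + theta) (x + sigma) `^ K (x + eps) (x + eps')
              * expR (- M (x + theta) (x + sigma)) * expR (r x)).
Proof.
pose m x := M (x + theta) (x + sigma); pose k x := K (x + eps) (x + eps').
have [D D0 kD] : exists2 D, 0 <= D &
    \forall x \near +oo, `|k x - (x + 2^-1)| <= D / x.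
  exact: mean_expansion.
(* [m x] lies between [x + theta] and [x + sigma], hence within [C] of [x], and is positive once
   [x > C]. *)
pose C := `|theta| + `|sigma|.
have C0 : 0 <= C by rewrite addr_ge0.
(* The logarithm of the ratio of Stirling's [x]^ x * expR (- x) * Num.sqrt x[to]m x
   [^ k x * expR (- m x)]. *)
pose E x := (x + 2^-1) * ln x - x - (k x * ln (m x) - m x).
have mbounds : \forall x \near +oo, 0 < m x /\ `|m x - x| <= C.
  near=> x.
  have Cx : C < x by near: x; apply: nbhs_pinfty_gt; exact: num_real.
  have := ler_norm theta; have := ler_norm (- theta); rewrite normrN => t1 t2.
  have := ler_norm sigma; have := ler_norm (- sigma); rewrite normrN => s1 s2.
  have t0 : 0 <= `|theta| by [].
  have s0 : 0 <= `|sigma| by [].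
  rewrite /C in Cx *.
  have /andP[] : Num.min (x + theta) (x + sigma) <= m x
      <= Num.max (x + theta) (x + sigma).
    by apply: M_mean; rewrite in_itv/= andbT; lra.
  rewrite ge_min le_max => lo hi; split.
    by case/orP: lo; lra.
  rewrite ler_norml; apply/andP; split; first by case/orP: lo; lra.
  by case/orP: hi; lra.
have E0 : E x @[x --> +oo] --> 0.
  pose b x : R := D * (2 * (Num.sqrt x)^-1)
    + (2 * C ^+ 2 + (2^-1 + D) * (2 * C)) * x^-1.
  have b0 : b x @[x --> +oo] --> (0 : R).
    have sqrtV : (Num.sqrt x)^-1 @[x --> +oo] --> (0 : R).
      exact: cvg_comp (cvg_sqrty R) (cvgVy R).
    have : b x @[x --> +oo] -->
        D * (2 * 0) + (2 * C ^+ 2 + (2^-1 + D) * (2 * C)) * 0.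
      apply: cvgD; last by apply: cvgM; [exact: cvg_cst|exact: cvgVy].
      by apply: cvgM; [exact: cvg_cst|apply: cvgM => //; exact: cvg_cst].
    by rewrite !mulr0 addr0.
  apply/norm_cvg0P; apply: (squeeze_cvgr _ (cvg_cst 0) b0).
  near=> x; rewrite normr_ge0/=; apply: exponent_bound => //.
  - by have [] : 0 < m x /\ `|m x - x| <= C by near: x.
  - by near: x.
rewrite /asymp_equiv.
have s0 : Num.sqrt (2 * pi : R) != 0.
  by rewrite gt_eqF// sqrtr_gt0 mulr_gt0 ?pi_gt0.
have lim : Gamma (x + 1) / (x `^ x * expR (- x) * Num.sqrt x)
    * (Num.sqrt (2 * pi))^-1 * expR (E x - r x) @[x --> +oo] -->
    Num.sqrt (2 * pi : R) / Num.sqrt (2 * pi : R) * expR (0 - 0).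
  apply: cvgM.
    by apply: cvgM; [exact: stirling|exact: cvg_cst].
  by apply: continuous_cvg; [exact: continuous_expR|exact: cvgB].
rewrite subr0 expR0 mulr1 divff// in lim.
apply: cvg_trans lim; apply: near_eq_cvg; near=> x.
have x0 : 0 < x by near: x; apply: nbhs_pinfty_gt; exact: num_real.
rewrite -/(m x) -/(k x).
have [m0 _] : 0 < m x /\ `|m x - x| <= C by near: x.
(* With [Num.sqrt x] written as a power, every factor except [Gamma] and the constant becomes an
   exponential, and the identity reduces to one between exponents. *)
rewrite -powR12_sqrt ?(ltW x0)// /powR !gt_eqF// -!expRD -!mulrA; congr (_ * _).
rewrite !invfM mulrCA; congr (_ * _); rewrite -!expRN -!expRD; congr expR.
by rewrite /E; ring.
Unshelve. all: by end_near. Qed.
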